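(* (Construction of partial orientations.) Let $G$ be a finite connected loopless undirected multigraph of genus $g=|E(G)|-|V(G)|+1$. Input: a divisor $D$ on $G$ with $\deg(D)\le g-1$. Procedure: work with pairs $(\mathcal{O}_i,D_i)$ of a partial orientation and a divisor such that $D_{\mathcal{O}_i}+D_i\sim D$ at each step. Initialize with $(\mathcal{O}_0,D_0)=(\mathcal{P},D-D_{\mathcal{P}})$, where $\mathcal{P}$ is an arbitrary partial orientation. At the $i$th step let $R_i$ be the set of vertices where $D_i<0$, $S_i$ the set of vertices where $D_i>0$, $T_i$ the set of vertices incident to an unoriented edge of $\mathcal{O}_i$, and $\bar S_i$ the set of vertices reachable from $S_i$ by a directed path in $\mathcal{O}_i$. While $D_i\ne 0$: Case 1: $S_i\neq\emptyset$ and $\mathcal{O}_i$ is not a full orientation. If $\bar S_i\cap T_i=\emptyset$, then the cut $(\bar S_i,\bar S_i^c)$ is nonempty and consistently oriented towards $\bar S_i$; reverse it, update $\mathcal{O}_i$, and continue. If $\bar S_i\cap T_i\ne\emptyset$, take a directed path $P$ from some $s\in S_i$ to some $t\in T_i$, perform a Jacob's ladder cascade along $P$ so that its initial edge $e$ incident to $s$ becomes unoriented (if $s=t$, take $e$ to be an unoriented edge at $s$), orient $e$ towards $s$, and set $D_{i+1}=D_i-(s)$, updating $\mathcal{O}_{i+1}$. Case 2: $S_i\neq\emptyset$ and $\mathcal{O}_i$ is a full orientation. Then $R_i\ne\emptyset$. If $\bar S_i\cap R_i\ne\emptyset$, reverse a directed path from some $s\in S_i$ to some $r\in R_i$ and set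 $D_{i+1}=D_i-(s)+(r)$, updating $\mathcal{O}_{i+1}$. Otherwise the nonempty cut $(\bar S_i,\bar S_i^c)$ is consistently oriented towards $\bar S_i$; reverse it, update, and continue. Case 3: $S_i=\emptyset$. Then $R_i\ne\emptyset$. If some $r\in R_i$ has an edge $e$ oriented towards it in $\mathcal{O}_i$, unorient $e$ and set $D_{i+1}=D_i+(r)$, updating $\mathcal{O}_{i+1}$. Otherwise $R_i$ is a set of sources; let $X$ be a maximal subset of $R_i$ with $G[X]$ connected and apply the modified unfurling algorithm (described in the context) to $\mathcal{O}_i$ and $X$. If it yields an orientation with an edge oriented towards some $r\in R_i$, unorient such an edge, set $D_{i+1}=D_i+(r)$, update $\mathcal{O}_{i+1}$, and continue. If it yields an acyclic partial orientation $\mathcal{O}$ (its second outcome), output $\mathcal{O}$ and $D'=D_{\mathcal{O}}+D_i$, as in (ii) below. If $D_i=0$, output $\mathcal{O}=\mathcal{O}_i$ and $D'=D_{\mathcal{O}_i}$, as in (i) below. This procedure terminates, and its output is a divisor $D'\sim D$ and a partial orientation $\mathcal{O}$ such that either (i) $D'=D_{\mathcal{O}}$, or (ii) $D'\lneq D_{\mathcal{O}}$ with $\mathcal{O}$ acyclic, which guarantees that $D$ is not linearly equivalent to a partially orientable divisor.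
   Context: A divisor on $G$ is a function $D:V(G)\to\mathbb{Z}$, also written as a formal sum of vertices $(v)$; $\deg(D)=\sum_vD(v)$. $D_1\le D_2$ means $D_1(v)\le D_2(v)$ for all $v$, and $D_1\lneq D_2$ means in addition $D_1\ne D_2$. $D\sim D'$ (linear equivalence) means $D-D'$ lies in the $\mathbb{Z}$-span of the columns of the Laplacian matrix of $G$. A partial orientation $\mathcal{O}$ is a choice of direction for each edge in some subset of $E(G)$, the other edges being unoriented; it is full if every edge is oriented, and acyclic if it has no directed cycle. Its divisor is $D_{\mathcal{O}}(v)=\mathrm{indeg}_{\mathcal{O}}(v)-1$, with $\mathrm{indeg}_{\mathcal{O}}(v)$ the number of edges oriented towards $v$. A divisor is partially orientable if it equals $D_{\mathcal{O}}$ for some partial orientation $\mathcal{O}$. A source is a vertex with no incoming edge. $(X,X^c)$ is the set of edges between $X$ and $X^c$; it is consistently oriented if all its edges are oriented in the same direction across the cut. $G[X]$ is the induced subgraph; the boundary of $X$ is the set of vertices of $X$ incident to an edge of $(X,X^c)$. Edge pivot at $v$: an edge oriented towards $v$ becomes unoriented and an unoriented edge incident to $v$ becomes oriented towards $v$. Jacob's ladder cascade: given a directed path $P$ from $u$ to $v$ and an unoriented edge incident to $v$, perform successive edge pivots along $P$ (starting at $v$), causing the initial edge of $P$ to become unoriented. Modified unfurling algorithm, with input a partial orientation and a set $S$ of sources with $G[S]$ connected: initialize $X_0:=S$. At the beginning of each step, look at the cut $(X_k,X_k^c)$ and perform any available edge pivots at vertices on the boundary of $X_k^c$ which bring oriented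 edges into the cut directed towards $X_k^c$. Afterwards, if there is an unoriented edge $(u,v)$ in the cut with $v\in X_k^c$, set $X_k:=X_k\cup\{v\}$. Otherwise the cut is consistently oriented towards $X_k^c$; reverse it. If this reversal causes an edge to be oriented towards a vertex of $S$, output this orientation (first outcome); otherwise set $X_{k+1}:=S$. If eventually $X_k=V(G)$, output the current orientation, which is acyclic (second outcome). *)

(* Defs.v *)
From HB Require Import structures.
From mathcomp Require Import all_boot all_order all_algebra.
From Stdlib Require Import Relation_Operators.

Set Implicit Arguments.
Unset Strict Implicit.
Unset Printing Implicit Defensive.
Import Order.TTheory GRing.Theory Num.Theory.
Local Open Scope ring_scope.

(* Parallel edges are distinct elements of [edge].  The two ends of an edge are
   named by booleans only in order to encode directions; this naming is
   arbitrary and none of the notions below depends on it. *)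
Record mgraph := MGraph {
  vertex : finType;
  edge : finType;
  endpt : edge -> bool -> vertex;
  loopless : forall e, endpt e false != endpt e true
}.
Arguments endpt {m} e b.

Section Graph.
Variable G : mgraph.
Local Notation V := (vertex G).
Local Notation E := (edge G).

Definition incident (e : E) (v : V) : bool :=
  (endpt e false == v) || (endpt e true == v).

Definition adjacent (u v : V) : bool :=
  (u != v) && [exists e : E, incident e u && incident e v].

(* Connectedness of G[X]; the empty graph is not considered connected. *)
Definition induced_connected (X : {set V}) : bool :=
  (X != set0) &&
  [forall u in X, forall v in X,
     connect [rel x y | [&& x \in X, y \in X & adjacent x y]] u v].

Definition connected_graph : bool := induced_connected [set: V].

Definition genus : int := #|E|%:Z - #|V|%:Z + 1.

Definition cut (X : {set V}) : {set E} :=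
  [set e | (endpt e false \in X) != (endpt e true \in X)].

Definition boundary (X : {set V}) : {set V} :=
  [set v in X | [exists e in cut X, incident e v]].

(** Divisors *)

Definition divisor := {ffun V -> int}.

Definition deg (D : divisor) : int := \sum_v D v.

Definition chip (v : V) : divisor := [ffun u => (u == v)%:Z].

Definition div_le (D1 D2 : divisor) : Prop := forall v, D1 v <= D2 v.
Definition div_lneq (D1 D2 : divisor) : Prop := div_le D1 D2 /\ D1 <> D2.

Definition laplacian (u v : V) : int :=
  if u == v then #|[set e : E | incident e u]|%:Z
  else - #|[set e : E | incident e u && incident e v]|%:Z.

Definition lin_equiv (D1 D2 : divisor) : Prop :=
  exists f : V -> int, D1 - D2 = \sum_v [ffun u => laplacian u v] *~ f v.

(** Partial orientations *)

(* [O e = Some b]: [e] is oriented towards [endpt e b];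
   [O e = None]: [e] is unoriented. *)
Definition orientation := {ffun E -> option bool}.

Definition ehead (O : orientation) (e : E) : option V := omap (endpt e) (O e).
Definition etail (O : orientation) (e : E) : option V :=
  omap (fun b => endpt e (~~ b)) (O e).

Definition full (O : orientation) : bool := [forall e, O e != None].

Definition indeg (O : orientation) (v : V) : nat :=
  #|[set e | ehead O e == Some v]|.

Definition div_of (O : orientation) : divisor := [ffun v => (indeg O v)%:Z - 1].

Definition partially_orientable (D : divisor) : Prop :=
  exists O : orientation, D = div_of O.

Definition arc (O : orientation) (u v : V) : bool :=
  [exists e, (etail O e == Some u) && (ehead O e == Some v)].

Definition acyclic (O : orientation) : Prop :=
  forall c : seq V, ucycle (arc O) c -> c = [::].

Definition reach (O : orientation) (A : {set V}) : {set V} :=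
  [set v | [exists s in A, connect (arc O) s v]].

(* A directed path is given by its sequence of edges (possibly empty) and does
   not repeat vertices. *)
Fixpoint diwalk (O : orientation) (u : V) (p : seq E) (v : V) : bool :=
  if p is e :: p' then
    if ehead O e is Some w then (etail O e == Some u) && diwalk O w p' v
    else false
  else u == v.
Definition dipath (O : orientation) (u : V) (p : seq E) (v : V) : bool :=
  diwalk O u p v && uniq (u :: pmap (ehead O) p).

(* every edge of (Y, Y^c) is oriented towards Y *)
Definition cut_towards (O : orientation) (Y : {set V}) : Prop :=
  forall e, e \in cut Y -> exists2 v, ehead O e = Some v & v \in Y.

Definition upd (O : orientation) (e : E) (o : option bool) : orientation :=
  [ffun x => if x == e then o else O x].
Definition unorient (O : orientation) (e : E) : orientation := upd O e None.
(* only meaningful when [v] is an end of [e] *)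
Definition orient_towards (O : orientation) (e : E) (v : V) : orientation :=
  upd O e (Some (endpt e true == v)).

Definition reverse (O : orientation) (A : {set E}) : orientation :=
  [ffun e => if e \in A then omap negb (O e) else O e].

(* edge pivot at [v]: [e], oriented towards [v], is replaced by [f] *)
Definition can_pivot (O : orientation) (v : V) (e f : E) : bool :=
  [&& ehead O e == Some v, O f == None & incident f v].
Definition pivot (O : orientation) (v : V) (e f : E) : orientation :=
  orient_towards (unorient O e) f v.

(* Jacob's ladder cascade along [p], with [f] an unoriented edge at the end of
   [p].  The pivot at the end of [p] is performed first; the edge left
   unoriented is [head f p], the initial edge of [p] (or [f] if [p] is empty). *)
Fixpoint jacob (O : orientation) (p : seq E) (f : E) : orientation :=
  if p is e :: p' then
    let O' := jacob O p' f in
    if ehead O' e is Some w then pivot O' w e (head f p') else O'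
  else O.

(** Modified unfurling algorithm *)

Inductive unfurl_state :=
| URun of orientation & {set V}   (* current orientation and X_k *)
| UFirst of orientation           (* first outcome *)
| USecond of orientation.         (* second outcome *)

(* a pivot at the boundary of X^c that brings a new oriented edge [f] into the
   cut; the edge [e] it replaces must therefore not lie in the cut *)
Definition cut_pivot (O : orientation) (X : {set V}) (v : V) (e f : E) : bool :=
  [&& v \in boundary (~: X), can_pivot O v e f, f \in cut X & e \notin cut X].

Definition no_cut_pivot (O : orientation) (X : {set V}) : Prop :=
  forall v e f, ~~ cut_pivot O X v e f.

Definition fully_oriented_cut (O : orientation) (X : {set V}) : Prop :=
  forall e, e \in cut X -> O e != None.

Definition edge_into (O : orientation) (S : {set V}) : Prop :=
  exists e, exists2 s, s \in S & ehead O e = Some s.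

Inductive unfurl_step (S : {set V}) : unfurl_state -> unfurl_state -> Prop :=
| UPivot O X v e f : cut_pivot O X v e f ->
    unfurl_step S (URun O X) (URun (pivot O v e f) X)
| UGrow O X v e : no_cut_pivot O X ->
    e \in cut X -> O e = None -> incident e v -> v \notin X ->
    unfurl_step S (URun O X) (URun O (v |: X))
| UReverseStop O X : X != setT -> no_cut_pivot O X -> fully_oriented_cut O X ->
    edge_into (reverse O (cut X)) S ->
    unfurl_step S (URun O X) (UFirst (reverse O (cut X)))
| UReverseRestart O X : X != setT -> no_cut_pivot O X ->
    fully_oriented_cut O X -> ~ edge_into (reverse O (cut X)) S ->
    unfurl_step S (URun O X) (URun (reverse O (cut X)) S)
| UAll O : unfurl_step S (URun O setT) (USecond O).

Definition unfurl_output (u : unfurl_state) (O : orientation) : Prop :=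
  u = UFirst O \/ u = USecond O.

(** Construction of partial orientations *)

Definition negset (D : divisor) : {set V} := [set v | D v < 0].   (* R_i *)
Definition posset (D : divisor) : {set V} := [set v | 0 < D v].   (* S_i *)
Definition freeset (O : orientation) : {set V} :=                 (* T_i *)
  [set v | [exists e, (O e == None) && incident e v]].
Definition Sbar (O : orientation) (D : divisor) : {set V} := reach O (posset D).

Inductive config :=
| Main of orientation & divisor
(* [Unfurling D X u]: the modified unfurling algorithm, called with the set of
   sources [X] while the current divisor is [D], is in state [u] *)
| Unfurling of divisor & {set V} & unfurl_state
| Output of divisor & orientation.

(* Nondeterminism represents the choices left open by the procedure. *)
Inductive step : config -> config -> Prop :=
| Done O :
    step (Main O 0) (Output (div_of O) O)
| Case1_cut O D : D != 0 -> posset D != set0 -> ~~ full O ->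
    Sbar O D :&: freeset O = set0 ->
    step (Main O D) (Main (reverse O (cut (Sbar O D))) D)
| Case1_path O D s t p f : D != 0 -> posset D != set0 -> ~~ full O ->
    Sbar O D :&: freeset O != set0 ->
    s \in posset D -> t \in freeset O -> dipath O s p t ->
    O f = None -> incident f t ->
    step (Main O D)
         (Main (orient_towards (jacob O p f) (head f p) s) (D - chip s))
| Case2_path O D s r p : D != 0 -> posset D != set0 -> full O ->
    Sbar O D :&: negset D != set0 ->
    s \in posset D -> r \in negset D -> dipath O s p r ->
    step (Main O D) (Main (reverse O [set e in p]) (D - chip s + chip r))
| Case2_cut O D : D != 0 -> posset D != set0 -> full O ->
    Sbar O D :&: negset D = set0 ->
    step (Main O D) (Main (reverse O (cut (Sbar O D))) D)
| Case3_unorient O D r e : D != 0 -> posset D = set0 ->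
    r \in negset D -> ehead O e = Some r ->
    step (Main O D) (Main (unorient O e) (D + chip r))
| Case3_unfurl O D X : D != 0 -> posset D = set0 ->
    ~ edge_into O (negset D) ->
    maxset (fun Y => (Y \subset negset D) && induced_connected Y) X ->
    step (Main O D) (Unfurling D X (URun O X))
| Unfurl_step D X u u' : unfurl_step X u u' ->
    step (Unfurling D X u) (Unfurling D X u')
| Unfurl_continue D X u O r e : unfurl_output u O ->
    r \in negset D -> ehead O e = Some r ->
    step (Unfurling D X u) (Main (unorient O e) (D + chip r))
| Unfurl_stop D X O :
    step (Unfurling D X (USecond O)) (Output (div_of O + D) O).

Definition reachable : config -> config -> Prop := clos_refl_trans config step.

(* Every run from [c] is finite. *)
Definition terminates (c : config) : Prop := Acc (fun c2 c1 => step c1 c2) c.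

(* The facts which the description of the procedure asserts along the way, for
   a run with input [D0]. *)
Definition assertions (D0 : divisor) (c : config) : Prop :=
  match c with
  | Main Q D =>
      [/\ lin_equiv (div_of Q + D) D0,
          D != 0 -> posset D != set0 -> ~~ full Q ->
            Sbar Q D :&: freeset Q = set0 ->
            cut (Sbar Q D) != set0 /\ cut_towards Q (Sbar Q D),
          D != 0 -> posset D != set0 -> full Q ->
            negset D != set0 /\
            (Sbar Q D :&: negset D = set0 ->
             cut (Sbar Q D) != set0 /\ cut_towards Q (Sbar Q D))
        & D != 0 -> posset D = set0 -> negset D != set0]
  | Unfurling D X (URun Q Y) =>
      no_cut_pivot Q Y -> fully_oriented_cut Q Y -> cut_towards Q (~: Y)
  | Unfurling D X (UFirst Q) => edge_into Q (negset D)
  | Unfurling D X (USecond Q) => acyclic Q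
  | Output _ _ => True
  end.

Definition is_output (c : config) : Prop := exists D' O, c = Output D' O.

End Graph.

(* Main.v *)
From mathcomp Require Import all_boot all_order all_algebra.
From mathcomp Require Import zify ring.
From Stdlib Require Import Relation_Operators.
Require Import Defs.

Set Implicit Arguments.
Unset Strict Implicit.
Unset Printing Implicit Defensive.
Import Order.TTheory GRing.Theory Num.Theory.
Local Open Scope ring_scope.

(* The sum of the [|D_i(v)|] drops at every step of the main procedure, except
   for cut reversals, which enlarge the reachable set [Sbar], and except for
   unfurling.

   Throughout unfurling, every edge oriented towards the current set [X] comes
   from a vertex of [X] of smaller rank (say, added earlier), and every vertex
   of [X] outside [S] is joined by an unoriented edge to a vertex of [X] of
   smaller rank.  When [X] is everything, this gives acyclicity, and a
   maximum-principle argument gives non-equivalence to a partially orientable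
   divisor.  Note that [D' <= D_O] with [O] acyclic is not enough for the
   latter: on a single edge, the empty orientation gives [(-1,-1)], below the
   divisor [(0,-1)] of an acyclic one.

   For termination of unfurling, fix [s] in [S] and weights [a(v)] that decrease
   geometrically with the distance to [s].  The total weight of the heads of
   oriented edges is bounded, is unchanged by pivots, and increases whenever a
   cut directed away from a set containing [s] is reversed. *)

Section Graph.
Variable G : mgraph.
Local Notation V := (vertex G).
Local Notation E := (edge G).
Implicit Types (e : E) (u v w s r : V) (X Y S : {set V}) (O Q : orientation G)
  (D : divisor G).

(** * Incidence and cuts *)

Lemma incidentP e v : reflect (exists b, endpt e b = v) (incident e v).
Proof.
apply: (iffP orP) => [[] /eqP <-|[[] <-]]; [by exists false | by exists true | |].
  by right.
by left.
Qed.

Lemma incident2P e u v : u != v -> incident e u -> incident e v ->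
  exists2 b, endpt e b = u & endpt e (~~ b) = v.
Proof.
move=> uv /incidentP[b bu] /incidentP[c cv]; exists b => //.
by case: b c bu cv => -[] // bu cv; rewrite -bu -cv eqxx in uv.
Qed.

Lemma in_cut e b X :
  (e \in cut X) = ((endpt e b \in X) != (endpt e (~~ b) \in X)).
Proof. by case: b; rewrite inE // eq_sym. Qed.

Lemma cutC X : cut (~: X) = cut X.
Proof. by apply/setP => e; rewrite !(in_cut _ false) !inE; do 2!case: (_ \in X). Qed.

(** With an empty cut, membership in [X] is constant along adjacency, so connectedness would carry
    it from a vertex inside to one outside. *)
Lemma cut_neq0 X : connected_graph G -> X != set0 -> X != setT -> cut X != set0.
Proof.
move=> /andP[_ conn] /set0Pn[x xX] XT; apply/eqP => cut0.
have /subsetPn[y _ yX] : ~~ ([set: V] \subset X) by rewrite subTset.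
have /forall_inP/(_ y (in_setT _)) := forall_inP conn x (in_setT _).
set a := [rel x y | _] => xy; suff cl : closed a (mem X).
  by move: yX; rewrite -(closed_connect cl xy) xX.
move=> u w /and3P[_ _ /andP[uw /existsP[e /andP[eu ew]]]].
have [b <- <-] := incident2P uw eu ew.
by have := in_cut e b X; rewrite cut0 inE => /esym/negbFE/eqP.
Qed.

Lemma ehead_Some O e v :
  ehead O e = Some v -> exists2 b, O e = Some b & endpt e b = v.
Proof. by rewrite /ehead; case: (O e) => //= b [<-]; exists b. Qed.

Lemma etail_Some O e v :
  etail O e = Some v -> exists2 b, O e = Some b & endpt e (~~ b) = v.
Proof. by rewrite /etail; case: (O e) => //= b [<-]; exists b. Qed.

(** * The Laplacian *)

(** Signed incidence matrix for the arbitrary naming of the ends; the sign cancels in every product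
    below. *)
Definition bdry e u : int := (endpt e false == u)%:R - (endpt e true == u)%:R.

(** The Laplacian applied to [f], as boundary after coboundary: each edge at [u] contributes the
    value of [f] at [u] minus that at its other end. *)
Definition lap (f : V -> int) u : int :=
  \sum_e bdry e u * (f (endpt e false) - f (endpt e true)).

(** The factorization of the Laplacian as the incidence matrix times its transpose. *)
Lemma laplacianE u v : laplacian u v = \sum_e bdry e u * bdry e v.
Proof.
rewrite /laplacian -!sum1_card -!natz; case: eqVneq => [<-|uv];
  rewrite natr_sum /= big_mkcond /= -?sumrN; apply: eq_bigr => e _;
  rewrite /bdry inE /incident; have := loopless e.
  by case: (eqVneq (endpt e false) u) => [->|_];
    case: (eqVneq (endpt e true) u) => [?|_]; rewrite ?eqxx.
case: (eqVneq (endpt e false) u) => [->|_];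
  case: (eqVneq (endpt e true) u) => [?|_];
  rewrite ?eqxx ?(negPf uv) //= => _.
- by case: (_ == v).
- have /negPf-> : endpt e true != v by rewrite (_ : endpt e true = u).
  by case: (_ == v).
by rewrite subrr mul0r oppr0.
Qed.

Lemma sum_bdry e (f : V -> int) :
  \sum_v bdry e v * f v = f (endpt e false) - f (endpt e true).
Proof.
have S w : \sum_v (w == v)%:R * f v = f w.
  rewrite (bigD1 w) //= eqxx mul1r big1 ?addr0 // => v.
  by rewrite eq_sym => /negPf->; rewrite mul0r.
by rewrite -!S -sumrB; apply: eq_bigr => v _; rewrite mulrBl.
Qed.

Lemma sum_bdry1 e : \sum_v bdry e v = 0.
Proof.
by rewrite -[RHS](subrr 1) -(sum_bdry e (fun=> 1)); under [RHS]eq_bigr do rewrite mulr1.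
Qed.

Lemma lin_equivP D1 D2 :
  lin_equiv D1 D2 <-> exists f, forall u, D1 u - D2 u = lap f u.
Proof.
have lapE f u : (\sum_v [ffun u => laplacian u v] *~ f v : divisor G) u = lap f u.
  rewrite sum_ffunE /lap.
  transitivity (\sum_v \sum_e bdry e u * (bdry e v * f v)).
    apply: eq_bigr => v _; under [RHS]eq_bigr do rewrite mulrA.
    rewrite -mulr_suml -laplacianE -mulrzz.
    by case: (f v) => n; [|rewrite ffunE]; rewrite ffunMnE ffunE.
  by rewrite exchange_big /=; apply: eq_bigr => e _; rewrite -mulr_sumr sum_bdry.
split=> -[f fE]; exists f; first by move=> u; rewrite -lapE -fE !ffunE.
by apply/ffunP => u; rewrite lapE -fE !ffunE.
Qed.

Lemma lapD f g u : lap (f \+ g) u = lap f u + lap g u.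
Proof. by rewrite /lap -big_split; apply: eq_bigr => e _ /=; ring. Qed.

Lemma lin_equiv_trans D2 D1 D3 :
  lin_equiv D1 D2 -> lin_equiv D2 D3 -> lin_equiv D1 D3.
Proof.
move=> /lin_equivP[f fE] /lin_equivP[g gE]; apply/lin_equivP; exists (f \+ g) => u.
by rewrite lapD -fE -gE; ring.
Qed.

Lemma lin_equiv_refl D : lin_equiv D D.
Proof.
apply/lin_equivP; exists (fun=> 0) => u.
by rewrite subrr /lap big1 // => e _; rewrite subrr mulr0.
Qed.

Lemma lin_equiv_deg D1 D2 : lin_equiv D1 D2 -> deg D1 = deg D2.
Proof.
move=> /lin_equivP[f fE]; apply/eqP; rewrite -subr_eq0 -sumrB.
under eq_bigr do rewrite fE; rewrite exchange_big big1 //= => e _.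
by rewrite -mulr_suml sum_bdry1 mul0r.
Qed.

(** * Divisors of orientations *)

Lemma indegE O v : (indeg O v)%:Z = \sum_e (ehead O e == Some v)%:R.
Proof.
rewrite /indeg -sum1_card -natz natr_sum big_mkcond /=; apply: eq_bigr => e _.
by rewrite inE; case: (_ == _).
Qed.

Lemma deg_div_of O : deg (div_of O) = #|[set e | O e != None]|%:Z - #|V|%:Z.
Proof.
rewrite /deg; under eq_bigr do rewrite ffunE indegE; rewrite sumrB; congr (_ - _).
  rewrite exchange_big -sum1_card -natz natr_sum [RHS]big_mkcond /=; apply: eq_bigr => e _.
  rewrite inE /ehead; case: (O e) => [b|] /=; last by rewrite big1.
  rewrite (bigD1 (endpt e b)) //= eqxx big1 ?addr0 // => v.
  by rewrite eq_sym (inj_eq Some_inj) => /negPf->.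
by rewrite sumr_const -natz.
Qed.

Lemma div_of_upd O e o v :
  div_of (upd O e o) v =
    div_of O v - (ehead O e == Some v)%:R + (omap (endpt e) o == Some v)%:R.
Proof.
rewrite !ffunE !indegE !(bigD1 (P := predT) e) //= {1}/ehead !ffunE eqxx.
rewrite (eq_bigr (fun i => (ehead O i == Some v)%:R)); first by ring.
by move=> i /negPf ie; rewrite /ehead ffunE ie.
Qed.

Lemma div_of_unorient O e v :
  ehead O e = Some v -> div_of (unorient O e) = div_of O - chip v.
Proof.
move=> ev; apply/ffunP => u; rewrite div_of_upd ev !ffunE addr0 /=.
by rewrite (inj_eq Some_inj) eq_sym natz.
Qed.

Lemma ehead_orient_towards O e v :
  incident e v -> ehead (orient_towards O e v) e = Some v.
Proof.
move=> /incidentP[b <-]; rewrite /ehead ffunE eqxx /=; congr Some.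
by case: b; rewrite ?eqxx // eq_sym (negPf (loopless e)).
Qed.

Lemma div_of_orient_towards O e v : O e = None -> incident e v ->
  div_of (orient_towards O e v) = div_of O + chip v.
Proof.
move=> Oe ev; apply/ffunP => u; rewrite div_of_upd {1}/ehead Oe subr0.
have := ehead_orient_towards O ev; rewrite /ehead ffunE eqxx => ->; rewrite !ffunE.
by rewrite (inj_eq Some_inj) eq_sym natz.
Qed.

Lemma div_of_pivot O v e f :
  can_pivot O v e f -> div_of (pivot O v e f) = div_of O.
Proof.
move=> /and3P[/eqP ev /eqP Of fv]; rewrite div_of_orient_towards //.
  by rewrite (div_of_unorient ev) subrK.
by rewrite ffunE; case: eqP.
Qed.

(** The heads along [p] are distinct and [f] is unoriented, so the pivots further along the path
    leave [e] oriented towards its head until its turn comes; the last conjunct carries this through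
    the induction. *)
Lemma jacobP O s p t f :
    diwalk O s p t -> uniq (pmap (ehead O) p) -> O f = None -> incident f t ->
  [/\ div_of (jacob O p f) = div_of O, jacob O p f (head f p) = None,
      incident (head f p) s & forall e, e != f -> e \notin p -> jacob O p f e = O e].
Proof.
move=> + + Of ft; elim: p s => [|e p IH] s /=; first by move=> /eqP->.
case ew: (ehead O e) => [w|] //= /andP[/eqP es walk] /andP[wp up].
have [dE hN hw same] := IH _ walk up.
have eNp : e \notin p by apply: contra wp => ep; rewrite mem_pmap -ew map_f.
have eNf : e != f by apply/eqP => ef; rewrite ef /ehead Of in ew.
have ew' : ehead (jacob O p f) e = Some w by rewrite /ehead same.
have piv : can_pivot (jacob O p f) w e (head f p) by rewrite /can_pivot ew' hN hw !eqxx.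
rewrite ew'; split.
- by rewrite (div_of_pivot piv).
- rewrite !ffunE eqxx; case: eqP => // eh.
  by rewrite -eh /ehead in hN; rewrite /ehead hN in ew'.
- by have [b _ <-] := etail_Some es; apply/incidentP; exists (~~ b).
move=> x xf; rewrite inE negb_or => /andP[xe xp].
rewrite !ffunE (negPf xe) same //; case: eqP => // xh.
by case: (p) xh xp xf => [|y p'] /= ->; rewrite ?inE ?eqxx.
Qed.

Lemma div_of_reverse O (A : {set E}) v :
  div_of (reverse O A) v =
    div_of O v + \sum_(e in A) ((etail O e == Some v)%:R - (ehead O e == Some v)%:R).
Proof.
rewrite !ffunE !indegE [\sum_(e in A) _]big_mkcond addrAC -big_split /=; congr (_ - 1).
apply: eq_bigr => e _; rewrite /ehead /etail ffunE.
by case: ifP => _; [case: (O e) => //= b; ring | rewrite addr0].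
Qed.

Lemma diwalk_uniq O s p t :
  diwalk O s p t -> uniq (pmap (ehead O) p) -> uniq p.
Proof.
elim: p s => //= e p IH s; case ew: (ehead O e) => [w|] //= /andP[_ walk] /andP[wp up].
by rewrite (IH _ walk up) andbT; apply: contra wp => ep; rewrite mem_pmap -ew map_f.
Qed.

(** Each reversed edge moves a chip from its head to its tail, and these moves telescope along the
    path. *)
Lemma div_of_reverse_path O s p t : dipath O s p t ->
  div_of (reverse O [set e in p]) = div_of O + chip s - chip t.
Proof.
move=> /andP[walk /andP[_ up]]; apply/ffunP => v; rewrite div_of_reverse.
rewrite (eq_bigl [in p]) => [|e]; last by rewrite inE.
rewrite -(big_uniq _ (diwalk_uniq walk up)) /=.
suff -> : \sum_(e <- p) ((etail O e == Some v)%:R - (ehead O e == Some v)%:R)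
    = (s == v)%:R - (t == v)%:R :> int.
  by rewrite !ffunE addrA ![v == _]eq_sym !natz.
elim: p s walk {up} => [|e p IH] s /=; first by move=> /eqP->; rewrite big_nil subrr.
case ew: (ehead O e) => [w|] //= /andP[/eqP es walk].
by rewrite big_cons (IH _ walk) es ew !(inj_eq Some_inj); ring.
Qed.

(** The witness is minus the indicator of [Y]: a vertex of [Y] loses one chip for each of its cut
    edges, and the other end gains it. *)
Lemma lin_equiv_reverse_cut O Y :
  cut_towards O Y -> lin_equiv (div_of (reverse O (cut Y))) (div_of O).
Proof.
move=> cY; apply/lin_equivP; exists (fun v => - (v \in Y)%:R) => v.
rewrite div_of_reverse addrAC subrr add0r /lap big_mkcond /=; apply: eq_bigr => e _.
case: ifP => [eY|]; last first.
  by rewrite (in_cut _ false) /= => /negbFE/eqP->; rewrite subrr mulr0.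
have [u /ehead_Some[b Ob <-] ebY] := cY e eY.
have := eY; rewrite (in_cut _ b) ebY eq_sym eqb_id => /negPf nY.
rewrite /etail /ehead Ob /bdry /= !(inj_eq Some_inj).
by case: b {Ob} ebY nY => /= -> ->; rewrite mulr0n mulr1n; ring.
Qed.

(** * Modified unfurling *)

(** The first clause yields acyclicity; the second supplies the unoriented edge that makes the chip
    count in [unfurl_not_orientable] strict outside [S]. *)
Definition ranked (rk : V -> nat) S O X : Prop :=
  (forall e b, O e = Some b -> endpt e b \in X ->
     endpt e (~~ b) \in X /\ (rk (endpt e (~~ b)) < rk (endpt e b))%N) /\
  (forall v, v \in X -> v \in S \/
     exists e b, [/\ O e = None, endpt e b = v, endpt e (~~ b) \in X
                   & (rk (endpt e (~~ b)) < rk v)%N]).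

Definition unfurl_inv S O X : Prop := S \subset X /\ exists rk, ranked rk S O X.

Lemma unfurl_inv_init S O : ~ edge_into O S -> unfurl_inv S O S.
Proof.
move=> nE; split=> //; exists (fun=> 0%N); split=> [e b Ob bS|v vS]; last by left.
by case: nE; exists e, (endpt e b); rewrite // /ehead Ob.
Qed.

Lemma cut_pivotP O X v e f : cut_pivot O X v e f ->
  [/\ can_pivot O v e f, v \notin X, f \in cut X & e \notin cut X].
Proof. by move=> /and4P[]; rewrite !inE => /andP[vX _] ? ? ?; split. Qed.

(** The pivot takes place outside [X], so no edge becomes oriented towards [X]; the edge [f] lies in
    the cut, while the unoriented edges of the second clause have both ends in [X]. The same rank
    therefore works. *)
Lemma unfurl_inv_pivot S O X v e f :
  cut_pivot O X v e f -> unfurl_inv S O X -> unfurl_inv S (pivot O v e f) X.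
Proof.
move=> /cut_pivotP[/and3P[_ _ fv] vX fX _] [SX [rk [rk1 rk2]]].
split=> //; exists rk; split=> [x b|u uX].
  have := ehead_orient_towards (unorient O e) fv; rewrite /ehead !ffunE eqxx => -[hd].
  case: (eqVneq x f) => [->|_]; first by move=> [<-]; rewrite hd (negPf vX).
  by case: ifP => // _; apply: rk1.
have [|[x [b [xN xu bX lt]]]] := rk2 u uX; [by left | right; exists x, b; split=> //].
have xf : x != f.
  by apply: contraTneq fX => <-; rewrite (in_cut _ b) xu uX bX.
by rewrite !ffunE (negPf xf) xN; case: ifP.
Qed.

(** The new vertex gets a rank above all others, and [e] is its unoriented edge to a smaller rank.
    That the edges into it all come from [X] is where the exhausted pivots enter. *)
Lemma unfurl_inv_grow S O X v e : no_cut_pivot O X -> e \in cut X ->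
  O e = None -> incident e v -> v \notin X ->
  unfurl_inv S O X -> unfurl_inv S O (v |: X).
Proof.
move=> npiv eX Oe ev vX [SX [rk [rk1 rk2]]].
have vE u : u \in X -> (u == v) = false by apply: contraTF => /eqP->.
have rkM u : (rk u < (\max_w rk w).+1)%N by rewrite ltnS leq_bigmax.
split; first by rewrite (subset_trans SX) // subsetUr.
exists (fun u => if u == v then (\max_w rk w).+1 else rk u); split.
  move=> x b Ox; rewrite !inE; case: eqVneq => [xv _|_ /= bX].
    (* Outside the cut, [x] could be traded for [e] by a pivot at [v]. *)
    have xX : x \in cut X.
      apply: contraT => xX; have := npiv v x e.
      have vb : v \in boundary (~: X).
        by rewrite !inE vX; apply/existsP; exists e; rewrite cutC eX.
      by rewrite /cut_pivot /can_pivot vb eX xX Oe ev /ehead Ox /= xv !eqxx.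
    by move: xX; rewrite (in_cut _ b) xv (negPf vX) => /negPn nX; rewrite nX orbT vE.
  by have [nX lt] := rk1 x b Ox bX; rewrite nX orbT vE.
move=> u; rewrite in_setU1; case: eqVneq => [-> _|_ /= uX].
  right; have /incidentP[b bv] := ev; exists e, b.
  move: eX; rewrite (in_cut _ b) bv (negPf vX) => /negPn nX.
  by rewrite in_setU1 nX orbT vE.
have [|[x [b [xN xu bX lt]]]] := rk2 u uX; [by left | right; exists x, b].
by rewrite in_setU1 bX orbT vE.
Qed.

Lemma unfurl_cut_towards S O X :
  unfurl_inv S O X -> fully_oriented_cut O X -> cut_towards O (~: X).
Proof.
move=> [_ [rk [rk1 _]]] fX e; rewrite cutC => eX.
case Oe: (O e) (fX _ eX) => [b|] // _.
exists (endpt e b); first by rewrite /ehead Oe.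
rewrite inE; apply/negP => bX; have [nX _] := rk1 e b Oe bX.
by move: eX; rewrite (in_cut _ b) bX nX.
Qed.

Lemma unfurl_acyclic S O : unfurl_inv S O setT -> acyclic O.
Proof.
move=> [_ [rk [rk1 _]]] [|x p] // /andP[/= cyc _].
have tr : transitive (relpre rk ltn) by move=> ? ? ? /=; apply: ltn_trans.
have /(order_path_min tr)/allP/(_ x) : path (relpre rk ltn) x (rcons p x).
  apply: sub_path cyc => u v /existsP[e /andP[/eqP eu /eqP ev]] /=.
  have [b Ob <-] := ehead_Some ev; have [c Oc <-] := etail_Some eu.
  by move: Oc; rewrite Ob => -[<-]; have [] := rk1 e b Ob (in_setT _).
by rewrite mem_rcons mem_head /= ltnn => /(_ isT).
Qed.

(* Let [v] be of minimal rank among the vertices where the firing vector [f]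
   is maximal.  Every edge from [v] to a vertex of smaller rank takes a chip
   from [v]; these include all edges oriented towards [v] and, for [v] outside
   [S], an unoriented one.  So fewer than [-1] chips remain at [v]. *)
Lemma unfurl_not_orientable S O D Q : S != set0 -> unfurl_inv S O setT ->
  div_le D 0 -> (forall v, v \in S -> D v < 0) ->
  ~ lin_equiv (div_of O + D) (div_of Q).
Proof.
move=> /set0Pn[s0 _] [_ [rk [rk1 rk2]]] D0 DS /lin_equivP[f fE].
pose u0 := [arg max_(u > s0) f u]%O.
have maxu u : f u <= f u0 by rewrite /u0; case: Order.TotalTheory.arg_maxP => // i _; apply.
pose v := [arg min_(u < u0 | f u == f u0) rk u]%N.
have [fv minv] : f v = f u0 /\ forall u, f u = f u0 -> (rk v <= rk u)%N.
  rewrite /v; case: arg_minnP => // i /eqP fi mi; split=> // u fu.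
  by apply: mi; apply/eqP.
have maxv u : f u <= f v by rewrite fv.
(* [c] marks the edges from [v] to a vertex of smaller rank; by the choice of [v], the
   integer-valued [f] drops by at least one along them, and no other edge brings [v] a chip. *)
pose c e := [exists b, (endpt e b == v) && (rk (endpt e (~~ b)) < rk v)%N].
have cP e b : endpt e b = v -> (rk (endpt e (~~ b)) < rk v)%N -> c e.
  by move=> eb lt; apply/existsP; exists b; rewrite eb eqxx.
have lapv : \sum_e (c e)%:R <= lap f v.
  apply: ler_sum => e _; rewrite /bdry; have := loopless e.
  have [/existsP[b /andP[/eqP bv lt]] nl|_ _] := boolP (c e).
    have flt : f (endpt e (~~ b)) < f v.
      rewrite lt_neqAle maxv andbT; apply: contraTneq lt => fe.
      by rewrite -leqNgt minv // fe fv.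
    case: b bv flt {lt} nl => /= -> flt nl; rewrite eqxx.
      by rewrite (negPf nl) /=; lia.
    by rewrite eq_sym (negPf nl) /=; lia.
  have := maxv (endpt e false); have := maxv (endpt e true).
  by do 2!case: eqVneq => [->|_]; rewrite ?subrr ?mul0r //=; lia.
(* Outside [S], the unoriented edge of the invariant is counted by [c] in addition to the incoming
   edges. *)
have indv : (indeg O v)%:Z + (v \notin S)%:R <= \sum_e (c e)%:R.
  have hc e : ehead O e == Some v -> c e.
    move=> /eqP/ehead_Some[b Ob bv].
    by have [_] := rk1 e b Ob (in_setT _); rewrite bv; apply: cP.
  rewrite indegE; have [|[x [b [xN xv _ lt]]]] := rk2 v (in_setT _).
    by move=> ->; rewrite addr0; apply: ler_sum => e _; case: eqP => // /eqP/hc->.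
  rewrite (bigD1 x) //= [leRHS](bigD1 x) //= {1}/ehead xN (cP _ _ xv lt) add0r [leRHS]addrC.
  apply: lerD; last by case: (v \notin S).
  by apply: ler_sum => e _; case: eqP => // /eqP/hc->.
have := fE v; have := D0 v; have := DS v; rewrite !ffunE.
move: (le_trans indv lapv); case: (v \in S) => /=; last by lia.
by move=> ? /(_ isT); lia.
Qed.

(** * Weights for the termination of unfurling *)

(** The rank is the distance to [s]: the last vertex but one on a shortest path is nearer. Tuples
    make the existence of a path of given length boolean, as [ex_minn] requires. *)
Lemma ex_rank s : connected_graph G -> exists rk : V -> nat, forall v, v != s ->
  exists e b, endpt e b = v /\ (rk (endpt e (~~ b)) < rk v)%N.
Proof.
move=> /andP[_ conn].
pose P v n := [exists p : n.-tuple V, path (@adjacent G) s p && (last s p == v)].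
have exP v : exists n, P v n.
  have /forall_inP/(_ v (in_setT _)) := forall_inP conn s (in_setT _).
  rewrite (@eq_connect _ _ (@adjacent G)) => [|x y]; last by rewrite /= !inE.
  move=> /connectP[p sp ->]; exists (size p); apply/existsP.
  by exists (in_tuple p); rewrite sp eqxx.
exists (fun v => ex_minn (exP v)) => v vs.
case: (ex_minnP (exP v)) => n /existsP[[p /= /eqP sz] /andP[sp /eqP lp]] _.
case: (lastP p) sz sp lp => [_ _ sv|q w]; first by rewrite -sv eqxx in vs.
rewrite last_rcons size_rcons rcons_path => <-.
move=> /andP[sq /andP[neq]] /existsP[e /andP[e1 e2]] wv.
have [b eb eN] := incident2P neq e1 e2; exists e, (~~ b); rewrite negbK eb eN wv.
split=> //; case: ex_minnP => m _; rewrite ltnS; apply.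
by apply/existsP; exists (in_tuple q); rewrite sq eqxx.
Qed.

Lemma ex_weight s : connected_graph G -> exists a : V -> nat,
  forall v, v != s -> (0 < a v)%N /\
    exists e b, endpt e b = v /\ (#|E|.+2 * a v <= a (endpt e (~~ b)))%N.
Proof.
(* The base exceeds [#|E|], so one head moved nearer to [s] can pay for all the cut edges, and it is
   at least [2] even without edges. *)
move=> /(@ex_rank s)[rk rkP]; exists (fun v => #|E|.+2 ^ (\max_w rk w - rk v))%N.
move=> v /rkP[e [b [bv lt]]]; split; first by rewrite expn_gt0.
exists e, b; split=> //; rewrite -expnS leq_exp2l // ltn_sub2l //.
by rewrite (leq_trans lt) // leq_bigmax.
Qed.

Definition weight (a : V -> nat) O : nat := \sum_v a v * indeg O v.

Lemma weightE a O : weight a O = (\sum_e oapp a 0 (ehead O e))%N.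
Proof.
transitivity (\sum_v \sum_e a v * (ehead O e == Some v))%N.
  apply: eq_bigr => v _; rewrite -big_distrr /indeg -sum1_card big_mkcond /=.
  by congr (_ * _)%N; apply: eq_bigr => e _; rewrite inE; case: (_ == _).
rewrite exchange_big; apply: eq_bigr => e _.
case: (ehead O e) => [w|] /=; last by rewrite big1 // => v _; rewrite muln0.
rewrite (bigD1 w) //= eqxx muln1 big1 ?addn0 // => v.
by rewrite eq_sym (inj_eq Some_inj) => /negPf->; rewrite muln0.
Qed.

Lemma weight_pivot a O v e f : can_pivot O v e f -> weight a (pivot O v e f) = weight a O.
Proof.
move=> piv; apply: eq_bigr => u _; congr (_ * _)%N.
by have /ffunP/(_ u) := div_of_pivot piv; rewrite !ffunE => /addIr[].
Qed.

Lemma weight_le a O : (weight a O <= #|E| * \sum_v a v)%N.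
Proof.
rewrite weightE -sum_nat_const; apply: leq_sum => e _.
by case: (ehead O e) => [w|] //=; rewrite (bigD1 w) //= leq_addr.
Qed.

(* The heaviest vertex [v] outside [X] outweighs every head of a cut edge, and
   its heavy neighbour, which lies in [X], outweighs [#|E|] copies of [v]. *)
Lemma weight_reverse s (a : V -> nat) O X :
    (forall v, v != s -> (0 < a v)%N /\
      exists e b, endpt e b = v /\ (#|E|.+2 * a v <= a (endpt e (~~ b)))%N) ->
    s \in X -> X != setT -> cut_towards O (~: X) ->
  (weight a O < weight a (reverse O (cut X)))%N.
Proof.
move=> aP sX XT cX.
have /subsetPn[v0 _ v0X] : ~~ ([set: V] \subset X) by rewrite subTset.
have [v vX maxv] := @arg_maxnP _ v0 (fun v => v \notin X) a v0X.
have [a0 [e [b [ebv le]]]] := aP v (contraNneq (fun E => etrans (congr1 _ E) sX) vX).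
have nX : endpt e (~~ b) \in X.
  apply: contraT => /maxv nX; have := leq_trans le nX; rewrite leqNgt => /negP[].
  by rewrite -[ltnLHS]mul1n ltn_pmul2r.
have eX : e \in cut X by rewrite (in_cut _ b) ebv (negPf vX) nX.
(* Edges off the cut keep their heads, so only the cut edges are compared; after the reversal, [e]
   alone outweighs all their former heads. *)
rewrite !weightE (bigID [in cut X]) /= [ltnRHS](bigID [in cut X]) /=.
rewrite [X in (_ < _ + X)%N](eq_bigr (fun e => oapp a 0 (ehead O e)))%N; last first.
  by move=> x /negPf xX; rewrite /ehead ffunE xX.
rewrite ltn_add2r [ltnRHS](bigD1 (P := [in cut X]) e) //=.
have -> : ehead (reverse O (cut X)) e = Some (endpt e (~~ b)).
  rewrite /ehead ffunE eX; have [|u /ehead_Some[c -> cu]] := cX e; first by rewrite cutC.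
  rewrite -cu inE => ncX; congr (Some (endpt e _)).
  by case: b c {cu le} ebv nX ncX => -[] //= ? ->.
apply: leq_trans (leq_addr _ _) => /=; apply: leq_trans le.
apply: (@leq_ltn_trans (#|cut X| * a v)).
  rewrite -sum_nat_const; apply: leq_sum => x xX.
  by have [|u -> ] := cX x; rewrite ?cutC // inE => /maxv.
by rewrite ltn_pmul2r // ltnW // ltnS ltnS max_card.
Qed.

(** * Reachability *)

Lemma sub_reach O X : X \subset reach O X.
Proof. by apply/subsetP => v vX; rewrite inE; apply/exists_inP; exists v. Qed.

Lemma reach_arc O X u v : u \in reach O X -> arc O u v -> v \in reach O X.
Proof.
rewrite !inE => /exists_inP[s sX su] uv; apply/exists_inP; exists s => //.
exact: connect_trans su (connect1 uv).
Qed.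

Lemma arcP O e b : O e = Some b -> arc O (endpt e (~~ b)) (endpt e b).
Proof. by move=> Oe; apply/existsP; exists e; rewrite /etail /ehead Oe !eqxx. Qed.

(** A cut edge directed outwards would extend the reachable set, and an unoriented one would have a
    free end inside it. *)
Lemma reach_cut_towards O X :
  reach O X :&: freeset O = set0 -> cut_towards O (reach O X).
Proof.
move=> RT e eR; case Oe: (O e) => [b|]; last first.
  have free c : endpt e c \notin reach O X.
    apply/negP => cR; have /setP/(_ (endpt e c)) := RT; rewrite !(in_setI, in_set0) cR inE.
    by move=> /existsPn/(_ e)/negP[]; rewrite Oe eqxx; apply/incidentP; exists c.
  by move: eR; rewrite (in_cut _ true) !(negPf (free _)).
exists (endpt e b); first by rewrite /ehead Oe.
apply: contraLR eR => bR; rewrite (in_cut _ b) (negPf bR) negbK eq_sym eqbF_neg.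
by apply: contra bR => nR; apply: reach_arc nR (arcP Oe).
Qed.

(** Directed paths from [X] never leave the reachable set, so they avoid the cut and survive the
    reversal; any reversed cut edge then leads to a new vertex. *)
Lemma reach_reverse_cut O X : cut_towards O (reach O X) ->
    cut (reach O X) != set0 ->
  reach O X \proper reach (reverse O (cut (reach O X))) X.
Proof.
set R := reach O X; set Q := reverse _ _ => cR /set0Pn[e eR].
have sub : R \subset reach Q X.
  apply/subsetP => v; rewrite inE => /exists_inP[s sX /connectP[p sp ->]].
  suff H x : x \in R -> x \in reach Q X -> path (arc O) x p -> last x p \in reach Q X.
    by apply: H sp; apply: (subsetP (sub_reach _ _)).
  elim: p x {sp} => //= y p IH x xR xQ /andP[xy]; have yR := reach_arc xR xy.
  apply: (IH) => //; apply: reach_arc xQ _; move: xy => /existsP[x' /andP[/eqP tx /eqP hy]].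
  apply/existsP; exists x'; rewrite /etail /ehead ffunE.
  have [b Ob bx] := etail_Some tx; have [c Oc cy] := ehead_Some hy.
  have bc : b = c by move: Oc; rewrite Ob => -[].
  have -> : (x' \in cut R) = false by rewrite (in_cut _ b) bx bc cy xR yR.
  by rewrite Ob /= bx bc cy !eqxx.
rewrite properE sub; apply/subsetPn.
have [v /ehead_Some[b Oe <-] bR] := cR e eR.
have Qe : Q e = Some (~~ b) by rewrite ffunE eR Oe.
exists (endpt e (~~ b)); last by move: eR; rewrite (in_cut _ b) bR; case: (_ \in R).
by have := arcP Qe; rewrite negbK; apply: reach_arc; apply: (subsetP sub).
Qed.

(** Removing loops makes the vertices distinct; an edge is then chosen for each arc. *)
Lemma connect_dipath O s t : connect (arc O) s t -> exists p, dipath O s p t.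
Proof.
move=> /connectP[q0 /shortenP[q qP uq _] ->].
suff [p walk pq] : exists2 p, diwalk O s p (last s q) & pmap (ehead O) p = q.
  by exists p; rewrite /dipath walk pq uq.
elim: q s qP {uq} => [|v q IH] s /=; first by exists [::] => //=.
move=> /andP[/existsP[e /andP[es ev]] /IH[p walk pq]]; exists (e :: p) => /=.
  by rewrite (eqP ev) es walk.
by rewrite (eqP ev) pq.
Qed.

End Graph.

(** * The main procedure *)

Section Procedure.
Variable G : mgraph.
Local Notation V := (vertex G).
Local Notation E := (edge G).
Implicit Types (e : E) (v s r : V) (X Y S : {set V}) (O Q : orientation G)
  (D : divisor G).

Lemma freeset_neq0 O : ~~ full O -> freeset O != set0.
Proof.
move=> /forallPn[e]; rewrite negbK => Oe; apply/set0Pn; exists (endpt e true).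
by rewrite inE; apply/existsP; exists e; rewrite Oe /incident eqxx orbT.
Qed.

Lemma freeset_eq0 O : full O -> freeset O = set0.
Proof.
move=> /forallP fO; apply/setP => v; rewrite !inE; apply/existsP => -[e /andP[Oe _]].
by have := fO e; rewrite Oe.
Qed.

(** [Y] witnesses that [Sbar] is not everything: it is [freeset O] in Case 1 and [negset D] in Case
    2. *)
Lemma Sbar_cut O D Y : connected_graph G -> posset D != set0 -> Y != set0 ->
    Sbar O D :&: freeset O = set0 -> Sbar O D :&: Y = set0 ->
  cut (Sbar O D) != set0 /\ cut_towards O (Sbar O D).
Proof.
move=> conn /set0Pn[s sD] /set0Pn[y yY] RT RY; split; last exact: reach_cut_towards.
apply: cut_neq0 => //; first by apply/set0Pn; exists s; apply: (subsetP (sub_reach _ _)).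
apply/eqP => RV; have /setP/(_ y) := RY; rewrite -/(Sbar O D) RV.
by rewrite setTI yY inE.
Qed.

(** A full orientation already has degree [genus G - 1], so a nonzero effective [D] would push the
    total above the bound. *)
Lemma negset_full D0 O D : deg D0 <= genus G - 1 -> lin_equiv (div_of O + D) D0 ->
  full O -> posset D != set0 -> negset D != set0.
Proof.
move=> degD0 /lin_equiv_deg dE /forallP fO /set0Pn[s]; rewrite inE => Ds.
apply: contraTneq degD0 => R0; rewrite -dE -ltNge.
have -> : deg (div_of O + D) = deg (div_of O) + deg D.
  by rewrite -big_split; apply: eq_bigr => v _; rewrite !ffunE.
rewrite deg_div_of (_ : [set e | O e != None] = setT); last first.
  by apply/setP => e; rewrite !inE fO.
have : 0 < deg D.
  rewrite /deg (bigD1 s) //= ltr_wpDr // sumr_ge0 // => v _.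
  by have /setP/(_ v) := R0; rewrite !inE => /negbT; rewrite -leNgt.
by rewrite cardsT /genus; lia.
Qed.

Lemma posset_eq0 D v : posset D = set0 -> D v <= 0.
Proof. by move=> /setP/(_ v); rewrite !inE => /negbT; rewrite -leNgt. Qed.

Lemma negset_neq0 D : D != 0 -> posset D = set0 -> negset D != set0.
Proof.
move=> + S0; apply: contraNneq => R0; apply/eqP/ffunP => v; rewrite [RHS]ffunE.
apply/eqP; rewrite eq_le posset_eq0 //=.
by have /setP/(_ v) := R0; rewrite !inE => /negbT; rewrite -leNgt.
Qed.

(** * The invariant of the procedure *)

Definition correct_output D0 (D' : divisor G) O : Prop :=
  lin_equiv D' D0 /\
  (D' = div_of O \/
   [/\ div_lneq D' (div_of O), acyclic O
     & ~ exists2 D'', partially_orientable D'' & lin_equiv D0 D'']).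

Definition unfurl_state_inv D0 D S u : Prop :=
  match u with
  | URun Q X => lin_equiv (div_of Q + D) D0 /\ unfurl_inv S Q X
  | UFirst Q => lin_equiv (div_of Q + D) D0 /\ edge_into Q S
  | USecond Q => lin_equiv (div_of Q + D) D0 /\ unfurl_inv S Q setT
  end.

(** During unfurling [D] is fixed and nowhere positive, and negative on the nonempty set [X]; at the
    second outcome this gives the strict inequality and the non-equivalence. *)
Definition inv D0 (c : config G) : Prop :=
  match c with
  | Main Q D => lin_equiv (div_of Q + D) D0
  | Unfurling D X u =>
      [/\ X != set0, X \subset negset D, posset D = set0 & unfurl_state_inv D0 D X u]
  | Output D' Q => correct_output D0 D' Q
  end.

Lemma edge_into_sub O S Y : S \subset Y -> edge_into O S -> edge_into O Y.
Proof. by move=> /subsetP SY [e [s sS es]]; exists e, s; rewrite ?SY. Qed.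

Lemma inv_assertions D0 c : connected_graph G -> deg D0 <= genus G - 1 ->
  inv D0 c -> assertions D0 c.
Proof.
move=> conn degD0; case: c => [O D|D S u|//] /= => [lin|].
  split=> //.
  - by move=> _ pD /freeset_neq0 fO RT; apply: (Sbar_cut conn pD fO RT RT).
  - move=> _ pD fO; have R0 := negset_full degD0 lin fO pD; split=> // RR.
    by apply: (Sbar_cut conn pD R0 _ RR); rewrite freeset_eq0 // setI0.
  - exact: negset_neq0.
case: u => [O X|O|O] /= [_ SR _ [_ uI]].
- by move=> _; apply: unfurl_cut_towards uI.
- exact: edge_into_sub uI.
- exact: unfurl_acyclic uI.
Qed.

Lemma lin_equiv_addr (D1 D2 D3 : divisor G) :
  lin_equiv D1 D2 -> lin_equiv (D1 + D3) (D2 + D3).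
Proof. by rewrite /lin_equiv opprD addrACA subrr addr0. Qed.

Lemma reverse_Sbar_inv D0 O D : inv D0 (Main O D) ->
    cut (Sbar O D) != set0 /\ cut_towards O (Sbar O D) ->
  inv D0 (Main (reverse O (cut (Sbar O D))) D).
Proof.
move=> lin [_ cS]; apply: lin_equiv_trans lin; apply: lin_equiv_addr.
exact: lin_equiv_reverse_cut.
Qed.

Lemma unfurl_step_inv D0 D S u u' :
  unfurl_step S u u' -> unfurl_state_inv D0 D S u -> unfurl_state_inv D0 D S u'.
Proof.
have lin_reverse O X : unfurl_inv S O X -> fully_oriented_cut O X ->
    lin_equiv (div_of O + D) D0 -> lin_equiv (div_of (reverse O (cut X)) + D) D0.
  move=> uI fX; apply: lin_equiv_trans; apply: lin_equiv_addr; rewrite -cutC.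
  by apply: lin_equiv_reverse_cut; apply: unfurl_cut_towards uI fX.
case=> [O X v e f piv|O X v e npiv eX Oe ev vX|O X _ _ fX ei|O X _ _ fX nE|O] /= [lin uI];
  split=> //; try exact: lin_reverse.
- by have [can _ _ _] := cut_pivotP piv; rewrite (div_of_pivot can).
- exact: unfurl_inv_pivot piv uI.
- exact: unfurl_inv_grow npiv eX Oe ev vX uI.
- exact: unfurl_inv_init.
Qed.

Lemma unorient_inv D0 O D r e : ehead O e = Some r ->
  inv D0 (Main O D) -> inv D0 (Main (unorient O e) (D + chip r)).
Proof. by move=> er; rewrite /= (div_of_unorient er) addrACA addNr addr0. Qed.

Lemma step_inv D0 c c' : connected_graph G -> deg D0 <= genus G - 1 ->
  step c c' -> inv D0 c -> inv D0 c'.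
Proof.
move=> conn degD0 st Ic; have := inv_assertions conn degD0 Ic.
case: st Ic => {c c'} [O|O D nz pD nf RT|O D s t p f nz pD nf RT sD tT path Of ft
  |O D s r p nz pD fO RR sD rD path|O D nz pD fO RR|O D r e nz pD rD er
  |O D X nz pD nE maxX|D X u u' ust|D X u O r e uO rD er|D X O] /= Ic As.
- by split; [rewrite -(addr0 (div_of O)) | left].
- by case: As => _ /(_ nz pD nf RT) H _ _; apply: reverse_Sbar_inv.
- have /andP[walk /andP[_ up]] := path.
  have [dE hN hs _] := jacobP walk up Of ft.
  by rewrite (div_of_orient_towards hN hs) dE addrACA subrr addr0.
- rewrite (div_of_reverse_path path) (_ : _ + _ = div_of O + D) //.
  by apply/ffunP => v; rewrite !ffunE; ring.
- by case: As => _ _ /(_ nz pD fO)[_ /(_ RR)] H _; apply: reverse_Sbar_inv.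
- exact: unorient_inv.
- have /andP[XR /andP[X0 _]] := maxsetp maxX; split=> //; split=> //.
  by apply: unfurl_inv_init => /(edge_into_sub XR).
- by case: Ic => X0 XR pD uI; split=> //; apply: unfurl_step_inv ust uI.
- case: Ic => _ _ _ uI; apply: (unorient_inv er) => /=.
  by case: uO uI => -> [].
- case: Ic => X0 XR pD [lin uI]; split=> //; right.
  have neg v : v \in X -> D v < 0 by move=> /(subsetP XR); rewrite inE.
  split; last 2 first.
  + exact: unfurl_acyclic uI.
  + move=> [D'' [Q ->] lin']; have le0 : div_le D 0 by move=> v; rewrite ffunE posset_eq0.
    exact: unfurl_not_orientable X0 uI le0 neg (lin_equiv_trans lin lin').
  split; first by move=> v; rewrite !ffunE gerDl posset_eq0.
  (* Strictness is seen at any vertex of [X], where [D] is negative. *)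
  have /set0Pn[s sX] := X0; move=> /ffunP/(_ s); rewrite ffunE => /eqP.
  by rewrite -subr_eq0 addrAC subrr add0r lt_eqF ?neg.
Qed.

(** * Progress: no configuration other than an output is stuck *)

Lemma unfurl_progress S O X : exists u, unfurl_step S (URun O X) u.
Proof.
case: (eqVneq X setT) => [->|XT]; first by exists (USecond O); constructor.
have [/existsP[v /existsP[e /existsP[f piv]]]|npiv] :=
  boolP [exists v, exists e, exists f, cut_pivot O X v e f].
  by exists (URun (pivot O v e f) X); constructor.
have {}npiv : no_cut_pivot O X.
  move=> v e f; apply: contra npiv => piv.
  by apply/existsP; exists v; apply/existsP; exists e; apply/existsP; exists f.
have [/existsP[e /andP[eX /eqP Oe]]|full] :=
  boolP [exists e, (e \in cut X) && (O e == None)].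
  have [b bX] : exists b, endpt e b \notin X.
    move: eX; rewrite (in_cut _ true) => neq.
    case: (boolP (endpt e true \in X)) neq => [_|nX _].
      by exists false; rewrite -[_ \notin _]/(true != _).
    by exists true.
  exists (URun O (endpt e b |: X)); apply: UGrow npiv eX Oe _ bX.
  by apply/incidentP; exists b.
have fX : fully_oriented_cut O X.
  by move=> e eX; apply: contra full => Oe; apply/existsP; exists e; rewrite eX.
pose Q := reverse O (cut X).
have [/existsP[e /existsP[s /andP[sS /eqP es]]]|nE] :=
  boolP [exists e, exists s, (s \in S) && (ehead Q e == Some s)].
  by exists (UFirst Q); constructor=> //; exists e, s.
exists (URun Q S); constructor=> // -[e [s sS es]].
by move/existsPn: nE => /(_ e)/existsPn/(_ s); rewrite sS es eqxx.
Qed.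

Lemma progress D0 c : connected_graph G -> deg D0 <= genus G - 1 ->
  inv D0 c -> is_output c \/ exists c', step c c'.
Proof.
move=> conn degD0 Ic; have := inv_assertions conn degD0 Ic.
case: c Ic => [O D|D S u|D' O] /= Ic As; last by left; exists D', O.
  right; have [D_0|nz] := eqVneq D 0.
    by exists (Output (div_of O) O); rewrite D_0; constructor.
  have [pD|pD] := eqVneq (posset D) set0.
    case: (boolP [exists e, exists r, (r \in negset D) && (ehead O e == Some r)]).
      move=> /existsP[e /existsP[r /andP[rR /eqP er]]].
      by exists (Main (unorient O e) (D + chip r)); constructor.
    move=> nE; have /set0Pn[r rR] := negset_neq0 nz pD.
    (* A singleton is connected, so a maximal connected subset containing [r] exists. *)
    have [] := @maxset_exists _
      (fun Y => (Y \subset negset D) && induced_connected Y) [set r].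
      rewrite sub1set rR /=; apply/andP; split.
        by apply/set0Pn; exists r; rewrite set11.
      apply/forall_inP => u /set1P->; apply/forall_inP => v /set1P->; exact: connect0.
    move=> X maxX _; exists (Unfurling D X (URun O X)); constructor=> //.
    move=> [e [s sR es]]; move/existsPn: nE => /(_ e)/existsPn/(_ s).
    by rewrite sR es eqxx.
  have [fO|nf] := boolP (full O).
    have [RR|RR] := eqVneq (Sbar O D :&: negset D) set0.
      by exists (Main (reverse O (cut (Sbar O D))) D); constructor.
    have /set0Pn[r /setIP[]] := RR.
    rewrite inE => /exists_inP[s sD /connect_dipath[p sr]] rR.
    by exists (Main (reverse O [set e in p]) (D - chip s + chip r)); constructor.
  have [RT|RT] := eqVneq (Sbar O D :&: freeset O) set0.
    by exists (Main (reverse O (cut (Sbar O D))) D); constructor.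
  have /set0Pn[t /setIP[]] := RT; rewrite inE => /exists_inP[s sD /connect_dipath[p st]] tT.
  have := tT; rewrite inE => /existsP[f /andP[/eqP Of ft]].
  exists (Main (orient_towards (jacob O p f) (head f p) s) (D - chip s)).
  by apply: Case1_path st Of ft.
case: Ic => X0 XR pD; case: u As => [O X|O|O] /= As [lin uI]; right.
- by have [u ust] := unfurl_progress S O X; exists (Unfurling D S u); constructor.
- have [e [r rR er]] := As; exists (Main (unorient O e) (D + chip r)).
  by apply: Unfurl_continue rR er; left.
- by exists (Output (div_of O + D) O); constructor.
Qed.

(** * Termination *)

Definition norm D : nat := (\sum_v `|D v|)%N.

Lemma norm_sub_chip D s : 0 < D s -> (norm (D - chip s)%R < norm D)%N.
Proof.
move=> Ds; rewrite /norm (bigD1 s) //= [ltnRHS](bigD1 s) //= -addSn leq_add //.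
  by rewrite !ffunE eqxx /=; lia.
by apply: leq_sum => v vs; rewrite !ffunE (negPf vs) subr0.
Qed.

Lemma norm_add_chip D r : D r < 0 -> (norm (D + chip r)%R < norm D)%N.
Proof.
move=> Dr; rewrite /norm (bigD1 r) //= [ltnRHS](bigD1 r) //= -addSn leq_add //.
  by rewrite !ffunE eqxx /=; lia.
by apply: leq_sum => v vr; rewrite !ffunE (negPf vr) addr0.
Qed.

(** Lexicographic descent on three quantities: the weight still missing from its bound ([k1]), the
    number of vertices outside [X], and the number of oriented edges off the cut ([k3]). A reversal
    with restart lowers the first; growth keeps it and lowers the second; a pivot keeps both and
    lowers the third. Returns to the main procedure have smaller norm and fall under the assumption
    on [Main]. *)
Lemma unfurling_terminates D0 D S u :
    connected_graph G -> deg D0 <= genus G - 1 ->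
    (forall O D', (norm D' < norm D)%N -> inv D0 (Main O D') -> terminates (Main O D')) ->
    inv D0 (Unfurling D S u) ->
  terminates (Unfurling D S u).
Proof.
move=> conn degD0 mainI.
have step_halts c c' (st : step c c') : inv D0 c ->
    match c' with Main _ D' => (norm D' < norm D)%N | Output _ _ => true | _ => false end ->
    terminates c'.
  move=> Ic; have := step_inv conn degD0 st Ic; case: c' {st} => [O D'|//|D' O _ _].
    by move=> + lt; apply: mainI.
  by constructor=> c' st; inversion st.
have haltsN (w : unfurl_state G) : inv D0 (Unfurling D S w) ->
    (forall w', unfurl_step S w w' -> terminates (Unfurling D S w')) ->
    terminates (Unfurling D S w).
  move=> Iw wI; constructor=> c' st; have := step_halts _ _ st Iw.
  inversion st as [ | | | | | | |D1 X1 u1 u2 ust|D1 X1 u1 O r e uO rD er|D1 X1 O]; subst.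
  - by move=> _; apply: wI.
  - by apply; apply: norm_add_chip; rewrite inE in rD.
  - by apply.
have haltsF O : inv D0 (Unfurling D S (UFirst O)) -> terminates (Unfurling D S (UFirst O)).
  by move=> /haltsN; apply=> w' st; inversion st.
have haltsS O :
    inv D0 (Unfurling D S (USecond O)) -> terminates (Unfurling D S (USecond O)).
  by move=> /haltsN; apply=> w' st; inversion st.
case: u => [O X|//|//] Iu; have /set0Pn[s sS] : S != set0 by case: Iu.
have [a aP] := ex_weight s conn.
(* By [weight_le] this subtraction is never truncated. *)
pose k1 O := (#|E| * \sum_v a v - weight a O)%N.
pose k3 O X := #|[set e | (O e != None) && (e \notin cut X)]|.
suff main m1 m2 m3 : forall O X, k1 O = m1 -> #|~: X| = m2 -> k3 O X = m3 ->
    inv D0 (Unfurling D S (URun O X)) -> terminates (Unfurling D S (URun O X)).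
  exact: (main (k1 O) #|~: X| (k3 O X)).
move=> {O X Iu}; elim/ltn_ind: m1 m2 m3 => m1 IH1 m2; elim/ltn_ind: m2 => m2 IH2 m3.
elim/ltn_ind: m3 => m3 IH3 O X E1 E2 E3 Iu; apply: (haltsN _ Iu) => w st.
have Iw : inv D0 (Unfurling D S w).
  by apply: step_inv conn degD0 _ Iu; constructor.
have [_ _ _ [_ uI]] := Iu.
have ind3 Q Y : k1 Q = m1 -> #|~: Y| = m2 -> (k3 Q Y < m3)%N ->
    inv D0 (Unfurling D S (URun Q Y)) -> terminates (Unfurling D S (URun Q Y)).
  by move=> e1 e2 lt; apply: IH3 lt _ _ e1 e2 (erefl _).
have ind2 Q Y : k1 Q = m1 -> (#|~: Y| < m2)%N ->
    inv D0 (Unfurling D S (URun Q Y)) -> terminates (Unfurling D S (URun Q Y)).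
  by move=> e1 lt; apply: IH2 lt _ _ _ e1 (erefl _) (erefl _).
have ind1 Q Y : (k1 Q < m1)%N ->
    inv D0 (Unfurling D S (URun Q Y)) -> terminates (Unfurling D S (URun Q Y)).
  by move=> lt; apply: IH1 lt _ _ _ _ (erefl _) (erefl _) (erefl _).
inversion st as [O' X' v e f piv|O' X' v e npiv eX Oe ev vX|O' X' XT npiv fX ei
  |O' X' XT npiv fX nE|O' EX]; subst w; subst.
- have [can vX fX eX] := cut_pivotP piv; have /and3P[ev /eqP Of fv] := can.
  apply: ind3 => //; first by rewrite /k1 (weight_pivot a can).
  apply: proper_card; rewrite properE; apply/andP; split.
    apply/subsetP => x; rewrite inE !ffunE => /andP[Ox xX]; rewrite inE xX andbT.
    have xf : x != f by apply: contraNneq xX => ->.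
    by move: Ox; rewrite (negPf xf); case: (x == e).
  apply/subsetPn; have [b Ob _] := ehead_Some (eqP ev); exists e.
    by rewrite inE Ob eX.
  rewrite inE !ffunE eqxx (_ : (e == f) = false) //; apply/eqP => ef.
  by rewrite -ef Ob in Of.
- apply: ind2 => //; apply: proper_card; rewrite properE setCS subsetUr /=.
  by apply/subsetPn; exists v; rewrite !inE ?eqxx.
- exact: haltsF.
- apply: ind1 => //; have [SX _] := uI.
  have lt := weight_reverse aP (subsetP SX _ sS) XT (unfurl_cut_towards uI fX).
  by rewrite ltn_sub2l // (leq_trans lt) // weight_le.
- exact: haltsS.
Qed.

(** Lexicographic descent on the norm of [D] and the number of vertices outside [Sbar]; a cut
    reversal keeps [D] and lowers the second. *)
Lemma main_terminates D0 O D : connected_graph G -> deg D0 <= genus G - 1 ->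
  inv D0 (Main O D) -> terminates (Main O D).
Proof.
move=> conn degD0.
suff main n m : forall O D, norm D = n -> #|~: Sbar O D| = m ->
    inv D0 (Main O D) -> terminates (Main O D) by apply: main (erefl _) (erefl _).
move=> {O D}; elim/ltn_ind: n m => n IHn m; elim/ltn_ind: m => m IHm O D En Em Ic.
constructor=> c' st; have := step_inv conn degD0 st Ic.
have smaller Q D' : (norm D' < n)%N -> inv D0 (Main Q D') -> terminates (Main Q D').
  by move=> lt; apply: IHn lt _ _ _ (erefl _) (erefl _).
have reverse_halts : cut (Sbar O D) != set0 /\ cut_towards O (Sbar O D) ->
    inv D0 (Main (reverse O (cut (Sbar O D))) D) ->
    terminates (Main (reverse O (cut (Sbar O D))) D).
  move=> [c0 ct]; apply: IHm (erefl _) => //; rewrite -Em.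
  by apply: proper_card; rewrite properC; apply: reach_reverse_cut.
have [_ cut1 cut2 _] := inv_assertions conn degD0 Ic.
inversion st as [O' _1 eD|O' D' nz pD nf RT|O' D' s t p f nz pD nf RT sD tT path Of ft
  |O' D' s r p nz pD fO RR sD rD path|O' D' nz pD fO RR|O' D' r e nz pD rD er
  |O' D' X nz pD nE maxX| | | ]; subst c'; subst.
- by move=> _; constructor=> c' st'; inversion st'.
- exact/reverse_halts/cut1.
- by apply: smaller; apply: norm_sub_chip; rewrite inE in sD.
(* Both chip moves lower the norm, since [r] is still negative after the chip at [s] is removed. *)
- rewrite !inE in sD rD; apply: smaller; apply: leq_trans (norm_sub_chip sD).
  apply: leqW; apply: norm_add_chip; rewrite !ffunE.
  by case: (r == s) => /=; lia.
- by have [_ /(_ RR)] := cut2 nz pD fO; apply: reverse_halts.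
- by apply: smaller; apply: norm_add_chip; rewrite inE in rD.
- by apply: unfurling_terminates => // Q D'; apply: smaller.
Qed.

End Procedure.

Theorem mainTheorem6 (G : mgraph) (connG : connected_graph G)
    (D : divisor G) (degD : deg D <= genus G - 1) (P : orientation G) :
  let start := Main P (D - div_of P) in
  [/\ terminates start,
      forall c, reachable start c -> assertions D c,
      forall c, reachable start c -> is_output c \/ exists c', step c c'
    & forall (D' : divisor G) (O : orientation G),
        reachable start (Output D' O) ->
        lin_equiv D' D /\
        (D' = div_of O \/
         [/\ div_lneq D' (div_of O),
             acyclic O
           & ~ exists2 D'' : divisor G,
                 partially_orientable D'' & lin_equiv D D''])].
Proof.
move=> start; have I0 : inv D start by rewrite /= addrC subrK; apply: lin_equiv_refl.
have Ir c : reachable start c -> inv D c.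
  move=> sc; elim: sc I0 => // [c1 c2 st|c1 c2 c3 _ IH1 _ IH2 /IH1 /IH2 //].
  exact: step_inv.
split.
- exact: main_terminates I0.
- by move=> c /Ir; apply: inv_assertions.
- by move=> c /Ir; apply: progress.
- by move=> D' O /Ir.
Qed.
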